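(* $$\lim_{k\to\infty}\mathrm{fib}^k\left(\frac{1}{1}\right)=\varphi,$$ where $\varphi=\frac{1+\sqrt{5}}{2}$ is the golden ratio.
   Context: The maps $\sigma$ and $\tau$ act on fractions $\frac{q}{p}$ with $p,q$ positive integers, $\gcd(p,q)=1$, by $\sigma\left(\frac{q}{p}\right)=\frac{p}{q}$ and $\tau\left(\frac{q}{p}\right)=\frac{q}{p+q}$. Products of maps denote composition, with the rightmost map applied first. Define $\mathrm{fib}:=\sigma\tau$ (first $\tau$, then $\sigma$) and let $\mathrm{fib}^k$ be its $k$-fold composition. The limit is a limit of real numbers. *)

(* Defs.v *)
From HB Require Import structures.
From mathcomp Require Import all_boot all_order all_algebra.
From mathcomp Require Import all_classical all_reals all_analysis.
Import Order.TTheory GRing.Theory Num.Theory.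
Import numFieldNormedType.Exports.

Set Implicit Arguments.
Unset Strict Implicit.
Unset Printing Implicit Defensive.

(* Reduced positive fractions q / p, kept as pairs of naturals. *)
Record fraction := Fraction {
  fnum : nat;
  fden : nat;
  fraction_proof : [&& 0 < fnum, 0 < fden & coprime fnum fden]
}.

Lemma sigma_proof (x : fraction) :
  [&& 0 < fden x, 0 < fnum x & coprime (fden x) (fnum x)].
Proof. by case: x => q p /= /and3P[q0 p0 qp]; rewrite q0 p0 coprime_sym. Qed.

Definition sigma (x : fraction) : fraction := Fraction (sigma_proof x).

Lemma tau_proof (x : fraction) :
  [&& 0 < fnum x, 0 < fden x + fnum x & coprime (fnum x) (fden x + fnum x)].
Proof.
by case: x => q p /= /and3P[q0 p0 qp]; rewrite q0 addn_gt0 p0 /coprime gcdnDr.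
Qed.

Definition tau (x : fraction) : fraction := Fraction (tau_proof x).

Definition fib (x : fraction) : fraction := sigma (tau x).

Definition one_fraction : fraction := @Fraction 1 1 isT.

Definition fraction_val (R : realType) (x : fraction) : R :=
  ((fnum x)%:R / (fden x)%:R)%R.

Definition golden_ratio (R : realType) : R := ((1 + Num.sqrt 5) / 2)%R.

(* Main.v *)
Require Import Defs.
From HB Require Import structures.
From mathcomp Require Import all_boot all_order all_algebra.
From mathcomp Require Import all_classical all_reals all_analysis.
From mathcomp Require Import ring lra.
Import Order.TTheory GRing.Theory Num.Theory.
Import numFieldNormedType.Exports.

Set Implicit Arguments.
Unset Strict Implicit.
Unset Printing Implicit Defensive.

Local Open Scope classical_set_scope.
Local Open Scope ring_scope.

(* On values, fib is x |-> 1 + 1/x, whose fixed point is the golden ratio phi.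
   Since (1 + 1/x) - phi = (phi - x) / (x phi), the map contracts the distance
   to phi by the factor 1/phi < 1 on x >= 1, a region that it preserves. *)

Lemma golden_ratio_gt1 (R : realType) : 1 < golden_ratio R.
Proof.
rewrite /golden_ratio ltr_pdivlMr // mul1r.
have : Num.sqrt 1 < Num.sqrt 5 :> R by rewrite ltr_sqrt // ltr1n.
by rewrite sqrtr1; lra.
Qed.

Lemma golden_ratio_sqr (R : realType) :
  golden_ratio R ^+ 2 = golden_ratio R + 1.
Proof.
have s5 : Num.sqrt 5 ^+ 2 = 5 :> R by rewrite sqr_sqrtr.
rewrite /golden_ratio; set s := Num.sqrt 5 in s5 *.
have -> : ((1 + s) / 2) ^+ 2 = (1 + 2 * s + s ^+ 2) / 4 by field.
by rewrite s5; field.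
Qed.

Lemma fraction_val_gt0 (R : realType) (x : fraction) : 0 < fraction_val R x.
Proof.
by case: x => q p qp /=; case/and3P: (qp) => q0 p0 _; rewrite divr_gt0 ?ltr0n.
Qed.

(** [tau] turns q / p into q / (p + q), and [sigma] inverts this to (p + q) / q = 1 + p / q. *)
Lemma fraction_val_fib (R : realType) (x : fraction) :
  fraction_val R (fib x) = 1 + (fraction_val R x)^-1.
Proof.
case: x => q p qp; case/and3P: (qp) => q0 _ _; rewrite /fraction_val /= invf_div.
by rewrite natrD mulrDl divff ?pnatr_eq0 -?lt0n // addrC.
Qed.

(** Supplies the hypothesis of [fib_contraction] along the whole orbit: the start has value 1, and
    any image under [fib] has value 1 plus a positive number. *)
Lemma fraction_val_iter_fib_ge1 (R : realType) k :
  1 <= fraction_val R (iter k fib one_fraction).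
Proof.
case: k => [|k]; first by rewrite /fraction_val /= divr1.
by rewrite iterS fraction_val_fib lerDl invr_ge0 ltW // fraction_val_gt0.
Qed.

Lemma fib_contraction (R : realType) (x : fraction) :
  1 <= fraction_val R x ->
  `|fraction_val R (fib x) - golden_ratio R| <=
  (golden_ratio R)^-1 * `|fraction_val R x - golden_ratio R|.
Proof.
rewrite fraction_val_fib; move: (fraction_val R x) => y y1.
have := golden_ratio_sqr R; have := golden_ratio_gt1 R.
move: (golden_ratio R) => phi phi1 phi2.
have y0 : 0 < y := lt_le_trans ltr01 y1.
have phi0 : 0 < phi := lt_trans ltr01 phi1.
(* The fixed-point equation, obtained from the quadratic one by cancelling a factor [phi]. *)
have phiE : phi = 1 + phi^-1.
  apply: (mulfI (lt0r_neq0 phi0)).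
  by rewrite -expr2 phi2 mulrDr mulr1 divff ?lt0r_neq0.
have -> : 1 + y^-1 - phi = phi^-1 * (y^-1 * (phi - y)).
  (* Expanding only the subtracted [phi] cancels the 1 and leaves [y^-1 - phi^-1]. *)
  by rewrite {1}phiE; field; rewrite !lt0r_neq0.
rewrite !normrM !normfV (distrC phi) (gtr0_norm phi0) (gtr0_norm y0).
(* After cancelling [phi^-1], the surplus factor [y^-1] is at most 1 because [1 <= y]. *)
by rewrite ler_pM2l ?invr_gt0 // ler_piMl // invf_le1.
Qed.

Theorem theorem3p2 (R : realType) :
  fraction_val R (iter k fib one_fraction) @[k --> \oo] --> golden_ratio R.
Proof.
set phi := golden_ratio R.
set u := fun k => fraction_val R (iter k fib one_fraction).
have phi0 : 0 < phi by rewrite (lt_trans ltr01) ?golden_ratio_gt1.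
(* The orbit starts at distance [|1 - phi|] from the limit, and each step gains a factor
   [phi^-1]. *)
have bound k : `|u k - phi| <= geometric `|1 - phi| phi^-1 k.
  elim: k => [|k IH]; first by rewrite /u /fraction_val /= divr1 mulr1.
  apply: le_trans (fib_contraction (fraction_val_iter_fib_ge1 R k)) _.
  by rewrite /= exprS mulrCA ler_wpM2l // invr_ge0 ltW.
have lim0 : geometric `|1 - phi| phi^-1 @ \oo --> 0.
  apply: cvg_geometric; rewrite ger0_norm ?invr_ge0 ?ltW //.
  by rewrite invf_lt1 // golden_ratio_gt1.
(* The geometric bound is eventually below [e], hence so is the distance. *)
apply/cvgrPdist_lt => e e0.
apply: (filterS _ (cvgr_lt _ lim0 e e0)) => k /=.
by rewrite (distrC phi); apply: le_lt_trans (bound k).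
Qed.
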